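(* Let $r\ge1$ and let $A=\{a(1),\dots,a(r)\}$ be a set of $r$ distinct integers such that $\sum_{i=1}^{k-1}a(i)<a(k)$ for all $1\le k\le r$ and such that the $2^r-1$ sums of nonempty subsets of $A$ are pairwise distinct; let $A'$ be the set of these sums and $\alpha(1)<\dots<\alpha(2^r-1)$ its elements. Let $N$ be any integer with $N\ge\alpha(2^r-1)$ and set $a(r+1):=N+a(1)$. Let $d,q$ be fixed with $|d|<1$, $|q|<1$. Then for every function $f$ of $x$ with $f(0)=1$ satisfying $$\prod_{j=1}^{r}\left(1-dxq^{a(j)}\right)f(x)=f(xq^N)+\sum_{j=1}^{r}\left(\sum_{m=0}^{r-j}d^m\sum_{\substack{\alpha\in A',\ \alpha<a(r+1)\\ w(\alpha)=j+m}}xq^{\alpha}\left((-x)^{m-1}{j+m-1\brack m-1}_{q^N}+(-x)^m{j+m\brack m}_{q^N}\right)\right)\prod_{h=1}^{j-1}\left(1-xq^{hN}\right)f\left(xq^{jN}\right),$$ we have $$f(1)=\prod_{k=1}^{r}\frac{(-q^{a(k)};q^N)_\infty}{(dq^{a(k)};q^N)_\infty}.$$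
   Context: For $\alpha\in A'$, $w(\alpha)$ is the number of elements of $A$ in the unique subset of $A$ summing to $\alpha$. The $q$-binomial coefficient is ${m\brack s}_q=\frac{(1-q^m)(1-q^{m-1})\cdots(1-q^{m-s+1})}{(1-q)(1-q^2)\cdots(1-q^s)}$ if $0\le s\le m$ and $0$ otherwise (so terms such as $(-x)^{-1}{n\brack -1}_{q^N}$ vanish). $(a;q)_\infty=\prod_{j\ge0}(1-aq^j)$.
   Formalization: The function f is additionally assumed continuous at 0 (without this, f(0)=1 and f(x)=0 for x≠0 is a counterexample when q≠0); the functional equation is required only for |x|≤1, with d, q, x complex. *)

(* Defs.v *)
From HB Require Import structures.
From mathcomp Require Import all_boot all_order all_algebra.
From mathcomp Require Import complex.
From mathcomp Require Import all_classical all_reals all_analysis.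
Set Implicit Arguments.
Unset Strict Implicit.
Unset Printing Implicit Defensive.
Import Order.TTheory GRing.Theory Num.Theory.
Import numFieldNormedType.Exports.
Local Open Scope classical_set_scope.
Local Open Scope ring_scope.

(* The integers a(1), ..., a(r) are the values of a : nat -> int at 1, ..., r.
   A subset of A is represented by its set of indices, index k being encoded
   by the element k - 1 of 'I_r. *)
Definition subset_sum (a : nat -> int) (r : nat) (B : {set 'I_r}) : int :=
  \sum_(i in B) a i.+1.

Definition nonempty_sums_distinct (a : nat -> int) (r : nat) : Prop :=
  forall B C : {set 'I_r}, B != finset.set0 -> C != finset.set0 ->
    subset_sum a B = subset_sum a C -> B = C.

(* The set A', as a strictly increasing sequence. *)
Definition sums (a : nat -> int) (r : nat) : seq int :=
  sort <=%R (undup [seq subset_sum a B | B : {set 'I_r} in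
                     [pred B : {set 'I_r} | B != finset.set0]]).

(* alpha(k) is 1-based. *)
Definition alpha (a : nat -> int) (r k : nat) : int := nth 0 (sums a r) k.-1.

(* The value 0 outside A' is a dummy. *)
Definition weight (a : nat -> int) (r : nat) (s : int) : nat :=
  if [pick B : {set 'I_r} | (B != finset.set0) && (subset_sum a B == s)]
    is Some B then #|B| else 0%N.

Definition qbinom (K : fieldType) (Q : K) (m s : int) : K :=
  if 0 <= s <= m then
    (\prod_(0 <= i < `|s|%N) (1 - Q ^ (m - i%:Z)))
      / (\prod_(1 <= i < `|s|%N.+1) (1 - Q ^+ i))
  else 0.

(* (b; Q)_oo, used for `|Q| < 1, where the limit exists. The regular module K^o
   carries the topology of the norm. *)
Definition qpoch_inf (K : numFieldType) (b Q : K) : K :=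
  lim ((fun n : nat => \prod_(0 <= j < n) (1 - b * Q ^+ j) : K^o) @ \oo).

(* At m = 0 the power (- x) ^ (m - 1) is multiplied by qbinom _ _ (- 1) = 0,
   so that the formula is also meaningful at x = 0. *)
Definition qdiff_coef (K : fieldType) (a : nat -> int) (r : nat) (N : int)
    (d q : K) (j : nat) (x : K) : K :=
  \sum_(0 <= m < (r - j).+1) d ^+ m *
    \sum_(s <- sums a r | (s < a r.+1) && (weight a r s == (j + m)%N))
      x * q ^ s *
      ((- x) ^ (m%:Z - 1) * qbinom (q ^ N) (j%:Z + m%:Z - 1) (m%:Z - 1)
       + (- x) ^+ m * qbinom (q ^ N) (j%:Z + m%:Z) m%:Z).

(* Main.v *)
Require Import Defs.
From HB Require Import structures.
From mathcomp Require Import all_boot all_order all_algebra.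
From mathcomp Require Import complex.
From mathcomp Require Import all_classical all_reals all_analysis.
From mathcomp Require Import ring lra.
Import Order.TTheory GRing.Theory Num.Theory.
Import numFieldNormedType.Exports.
Local Open Scope classical_set_scope.
Local Open Scope ring_scope.
Local Open Scope complex_scope.

(** Put Q = q^N, y_k = q^a(k) and u_n = f(Q^n).  Since the sum of q^alpha over
    the alpha in A' of weight s is the elementary symmetric function
    e_s(y_1, ..., y_r), the equation at x = Q^n is a linear recurrence
    p(n) u_n = sum_j b_j(Q^n) u_(n+j).  If v solves the adjoint recurrence
    p(n) v_n = [n = 0] + sum_j b_j(Q^(n-j)) v_(n-j), summation by parts gives
    f(1) = u_0 = lim v_n, because u_n -> 1, b_1(Q^n) -> 1 and b_j(Q^n) -> 0
    for j > 1.

    Write v_n = (Q;Q)_n w_n, let z be the shift (multiplication of generating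
    series by z), tau the multiplication of the n-th term by Q^n, and
    u = z - d tau.  As tau z = Q z tau, the q-binomial theorem turns the
    adjoint recurrence into E(u) tau w + d H(u) tau w = (1 - z) w, where
    E(X) = prod_k (1 + y_k X) and H = (E - 1) / X.  Let T scale the n-th term
    by 1 / (dy;Q)_(n+1) and let B be the multiplication by (-yQz;Q)_oo.  Then
    TB commutes with u, and w |-> TB(1 + yz)w takes a solution for
    y_1, ..., y_(r-1) to one for y_1, ..., y_(r-1), y.  On limits it acts as
    multiplication by (-y;Q)_oo / (dy;Q)_oo. *)

Set Implicit Arguments.
Unset Strict Implicit.
Unset Printing Implicit Defensive.

(** * The adjoint recurrence *)

Section Operators.
Context {K : fieldType}.
Implicit Types (X Y : nat -> K) (d y Q c : K) (ys : seq K) (n : nat).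

Definition addz c X Y n := X n + c * Y n.

Definition delay X n := if n is k.+1 then X k else 0.

Definition dilate Q X n := Q ^+ n * X n.

(* The operator u = z - d tau. *)
Definition uop d Q X := addz (- d) (delay X) (dilate Q X).

Definition convol (e : nat -> K) X n : K := \sum_(k < n.+1) e k * X (n - k)%N.

Definition qpoch Q c n := \prod_(0 <= j < n) (1 - c * Q ^+ j).

Lemma qpochS Q c n : qpoch Q c n.+1 = qpoch Q c n * (1 - c * Q ^+ n).
Proof. by rewrite /qpoch big_nat_recr. Qed.

Lemma qpoch0 Q c : qpoch Q c 0 = 1.
Proof. by rewrite /qpoch big_geq. Qed.

Lemma qpoch_neq0 Q c n :
  (forall m, 1 - c * Q ^+ m != 0) -> qpoch Q c n != 0.
Proof.
move=> c1; elim: n => [|n IH]; first by rewrite qpoch0 oner_neq0.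
by rewrite qpochS mulf_neq0.
Qed.

(* The coefficients of the series (- c z; Q)_oo. *)
Definition euler Q c n := \prod_(0 <= i < n) (c * Q ^+ i / (1 - Q ^+ i.+1)).

Lemma eulerS Q c n :
  euler Q c n.+1 = euler Q c n * (c * Q ^+ n / (1 - Q ^+ n.+1)).
Proof. by rewrite /euler big_nat_recr. Qed.

Lemma euler0 Q c : euler Q c 0 = 1.
Proof. by rewrite /euler big_geq. Qed.

Definition twist d Q y X n :=
  (qpoch Q (d * y) n.+1)^-1 * convol (euler Q (y * Q)) X n.

(** * Linearity and commutation relations of the operators *)

Lemma delay_addz c X Y : delay (addz c X Y) = addz c (delay X) (delay Y).
Proof. by apply/funext => -[|n]; rewrite /addz /= ?mulr0 ?addr0. Qed.

Lemma dilate_addz Q c X Y :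
  dilate Q (addz c X Y) = addz c (dilate Q X) (dilate Q Y).
Proof. by apply/funext => n; rewrite /addz /dilate; ring. Qed.

Lemma uop_addz d Q c X Y :
  uop d Q (addz c X Y) = addz c (uop d Q X) (uop d Q Y).
Proof.
rewrite /uop delay_addz dilate_addz.
by apply/funext => n; rewrite /addz; ring.
Qed.

Lemma convol_addz (e : nat -> K) c X Y :
  convol e (addz c X Y) = addz c (convol e X) (convol e Y).
Proof.
apply/funext => n; rewrite /addz /convol mulr_sumr -big_split /=.
by apply: eq_bigr => k _; ring.
Qed.

Lemma twist_addz d Q y c X Y :
  twist d Q y (addz c X Y) = addz c (twist d Q y X) (twist d Q y Y).
Proof. by apply/funext => n; rewrite /twist convol_addz /addz; ring. Qed.

Lemma delay_convol (e : nat -> K) X : delay (convol e X) = convol e (delay X).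
Proof.
apply/funext => -[|n] /=; first by rewrite /convol big_ord1 mulr0.
rewrite /convol [RHS]big_ord_recr /= subnn mulr0 addr0.
by apply: eq_bigr => k _; rewrite subSn // -ltnS.
Qed.

(* Since B(z) = (- y Q z; Q)_oo satisfies (1 + y Q z) B(Q z) = B(z). *)
Lemma dilate_convol Q y X : (forall n, 1 - Q ^+ n.+1 != 0) ->
  dilate Q (convol (euler Q (y * Q)) (addz y X (delay X)))
  = convol (euler Q (y * Q)) (dilate Q X).
Proof.
move=> Q1; set e := euler _ _; apply/funext => n.
rewrite /dilate convol_addz /addz -delay_convol /convol.
case: n => [|n] /=; first by rewrite !big_ord1 /=; ring.
rewrite big_ord_recl [in RHS]big_ord_recl /= !mulr_sumr.
rewrite mulrDr mulrDr -addrA; congr (_ + _); first by rewrite subn0; ring.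
rewrite !mulr_sumr -big_split /=; apply: eq_bigr => k _.
rewrite /bump leq0n add1n subSS.
have kn : (k <= n)%N by rewrite -ltnS.
rewrite {1 3}/e eulerS -/(e k) -[in Q ^+ n.+1](subnK kn) -addnS exprD.
move: (Q1 k) (e k) (X (n - k)%N) (Q ^+ (n - k)); rewrite exprS => Qk u v w.
by field; rewrite Qk.
Qed.

(** Moving z past T leaves the last factor of (dy;Q)_(n+1) uncancelled; at n = 0 both sides
    vanish. *)
Lemma delay_twist d Q y X n : (forall n, 1 - d * y * Q ^+ n != 0) ->
  delay (twist d Q y X) n =
  (qpoch Q (d * y) n.+1)^-1 * (1 - d * y * Q ^+ n)
    * convol (euler Q (y * Q)) (delay X) n.
Proof.
move=> y1; rewrite -delay_convol; case: n => [|n] /=; first by rewrite mulr0.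
by rewrite /twist [in RHS]qpochS invfM -(mulrA _ _ (1 - _)) mulVf // mulr1.
Qed.

(** Moving z past T adds - dy tau B z, and tau B + y tau B z = B tau by [dilate_convol], so - d tau
    B becomes - d B tau. *)
Lemma uop_twist d Q y X :
  (forall n, 1 - Q ^+ n.+1 != 0) -> (forall n, 1 - d * y * Q ^+ n != 0) ->
  uop d Q (twist d Q y X) = twist d Q y (uop d Q X).
Proof.
move=> Q1 y1; apply/funext => n; rewrite /uop twist_addz /addz delay_twist //.
rewrite /twist -dilate_convol // /dilate convol_addz /addz; ring.
Qed.

Lemma dilate_twist d Q y X : (forall n, 1 - Q ^+ n.+1 != 0) ->
  dilate Q (twist d Q y (addz y X (delay X))) = twist d Q y (dilate Q X).
Proof.
move=> Q1; apply/funext => n.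
by rewrite /twist -dilate_convol // /dilate; ring.
Qed.

(* E(u) and H(u), where E is the product of the 1 + y X for y in ys and
   H = (E - 1) / X. *)
Fixpoint eop d Q ys X :=
  if ys is y :: ys' then
    addz y (eop d Q ys' X) (uop d Q (eop d Q ys' X)) else X.

Fixpoint hop d Q ys X :=
  if ys is y :: ys' then
    addz y (addz y (hop d Q ys' X) (uop d Q (hop d Q ys' X))) X
  else fun=> 0.

(* [twist] is the operator TB, [sol] the sequence w and [adj] below the
   sequence v of the introduction. *)
Fixpoint sol d Q ys :=
  if ys is y :: ys' then
    twist d Q y (addz y (sol d Q ys') (delay (sol d Q ys')))
  else fun n => (qpoch Q Q n)^-1.

Lemma eop_twist d Q ys y X :
  (forall n, 1 - Q ^+ n.+1 != 0) -> (forall n, 1 - d * y * Q ^+ n != 0) ->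
  eop d Q ys (twist d Q y X) = twist d Q y (eop d Q ys X).
Proof.
by move=> Q1 y1; elim: ys => //= z ys ->; rewrite uop_twist // -twist_addz.
Qed.

Lemma hop_twist d Q ys y X :
  (forall n, 1 - Q ^+ n.+1 != 0) -> (forall n, 1 - d * y * Q ^+ n != 0) ->
  hop d Q ys (twist d Q y X) = twist d Q y (hop d Q ys X).
Proof.
move=> Q1 y1; elim: ys => [|z ys] /=.
  by apply/funext => n; rewrite /twist /convol big1 ?mulr0 // => k; rewrite mulr0.
by move=> ->; rewrite uop_twist // -!twist_addz.
Qed.

Lemma sol_eq d Q ys :
  (forall n, 1 - Q ^+ n.+1 != 0) ->
  (forall y, y \in ys -> forall n, 1 - d * y * Q ^+ n != 0) ->
  addz d (eop d Q ys (dilate Q (sol d Q ys)))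
         (hop d Q ys (dilate Q (sol d Q ys)))
  = addz (-1) (sol d Q ys) (delay (sol d Q ys)).
Proof.
move=> Q1; elim: ys => [|y ys IH] yQ.
  (* Without parameters E = 1 and H = 0, and the claim is 1/(Q;Q)_n - 1/(Q;Q)_(n-1) =
     Q^n/(Q;Q)_n. *)
  apply/funext => -[|n]; rewrite /addz /dilate /=; first by ring.
  have Q1' m : 1 - Q * Q ^+ m != 0 by rewrite -exprS.
  rewrite qpochS exprS; move: (qpoch_neq0 n Q1') (Q1' n).
  move: (qpoch _ _ _) (Q ^+ n) => u v u0 v0.
  by field; rewrite u0 v0.
have {}IH := IH (fun z zys => yQ z (mem_behead (s := y :: ys) zys)).
have y1 := yQ y (mem_head _ _).
have -> : sol d Q (y :: ys) = twist d Q y (addz y (sol d Q ys) (delay (sol d Q ys))).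
  by [].
rewrite dilate_twist // eop_twist // hop_twist //.
set W := sol d Q ys in IH *.
(* The commutation rules give (1 - z) TB(1 + yz) W = TB((1 + yu)(1 - z) W + dy tau W). With the
   induction hypothesis this becomes the equation for [y :: ys], because the new H is (1 + yX) H +
   y. *)
have -> : addz (-1) (twist d Q y (addz y W (delay W)))
    (delay (twist d Q y (addz y W (delay W)))) =
  twist d Q y (addz (d * y) (addz y (addz (-1) W (delay W))
       (uop d Q (addz (-1) W (delay W)))) (dilate Q W)).
  apply/funext => n; rewrite {1}/addz delay_twist // delay_addz.
  have /(congr1 (fun F => F n)) := dilate_convol y (delay W) Q1.
  rewrite /twist uop_addz !convol_addz /addz {1}/dilate !mulrDr => Z.
  rewrite -Z; ring.
rewrite -twist_addz -IH; congr (twist _ _ _ _) => /=.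
rewrite uop_addz; apply/funext => n; rewrite /addz; ring.
Qed.

(** * Normal ordering of the powers of u *)

Definition gauss Q j m := qpoch Q Q (j + m) / (qpoch Q Q j * qpoch Q Q m).

Lemma gauss_pascal Q j m : (forall n, 1 - Q ^+ n.+1 != 0) ->
  gauss Q j.+1 m.+1 = gauss Q j m.+1 + Q ^+ j.+1 * gauss Q j.+1 m.
Proof.
move=> Q1; have Q1' n : 1 - Q * Q ^+ n != 0 by rewrite -exprS.
have := (Q1' j, Q1' m, qpoch_neq0 j Q1', qpoch_neq0 m Q1').
rewrite /gauss !addSn !addnS !qpochS -!exprS !exprS exprD.
move: (qpoch Q Q j) (qpoch Q Q m) (qpoch Q Q (j + m)) => A B C.
move: (Q ^+ j) (Q ^+ m) => x y [[[xQ yQ] A0] B0].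
by field; rewrite A0 B0 xQ yQ.
Qed.

Lemma gauss0n Q m : (forall n, 1 - Q ^+ n.+1 != 0) -> gauss Q 0 m = 1.
Proof.
move=> Q1; have Q1' n : 1 - Q * Q ^+ n != 0 by rewrite -exprS.
by rewrite /gauss qpoch0 mul1r add0n divff // qpoch_neq0.
Qed.

Lemma gaussn0 Q m : (forall n, 1 - Q ^+ n.+1 != 0) -> gauss Q m 0 = 1.
Proof.
move=> Q1; have Q1' n : 1 - Q * Q ^+ n != 0 by rewrite -exprS.
by rewrite /gauss qpoch0 mulr1 addn0 divff // qpoch_neq0.
Qed.

(** Normal form of words in z and tau: the shifts stand to the left of the dilations. *)
Definition monom Q j m X := iter j delay (iter m (dilate Q) X).

Lemma monomE Q j m X n :
  monom Q j m X n = if (j <= n)%N then Q ^+ (n - j) ^+ m * X (n - j)%N else 0.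
Proof.
rewrite /monom; elim: j n => [|j IH] n.
  rewrite subn0 /=; elim: m => [|m IH]; first by rewrite mul1r.
  by rewrite /= /dilate IH exprS mulrA.
by rewrite iterS; case: n => [|n] //=; rewrite IH ltnS subSS.
Qed.

Lemma dilate_monom Q j m X n :
  dilate Q (monom Q j m X) n = Q ^+ j * monom Q j m.+1 X n.
Proof.
rewrite /dilate !monomE; case: leqP => [jn|]; last by rewrite !mulr0.
by rewrite -{1}(subnKC jn) exprD exprS; ring.
Qed.

(* The q-binomial theorem for u = z - d tau, where tau z = Q z tau. *)
Lemma iter_uop d Q s X n : (forall n, 1 - Q ^+ n.+1 != 0) ->
  iter s (uop d Q) X n =
  \sum_(j < s.+1) gauss Q j (s - j) * (- d) ^+ (s - j) * monom Q j (s - j) X n.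
Proof.
move=> Q1; elim: s n => [|s IH] n.
  by rewrite big_ord1 gauss0n // !mul1r.
rewrite iterS /uop /addz.
have -> : delay (iter s (uop d Q) X) n = \sum_(j < s.+1)
    gauss Q j (s - j) * (- d) ^+ (s - j) * monom Q j.+1 (s - j) X n.
  case: n => [|n] /=; last by rewrite IH.
  by rewrite big1 // => j _; rewrite mulr0.
have -> : dilate Q (iter s (uop d Q) X) n = \sum_(j < s.+1) Q ^+ j *
    (gauss Q j (s - j) * (- d) ^+ (s - j) * monom Q j (s - j).+1 X n).
  rewrite /dilate IH mulr_sumr; apply: eq_bigr => j _.
  by rewrite mulrCA -/(dilate Q _ n) dilate_monom mulrCA.
(* [F] comes from the leading z and [G] from the leading tau, reindexed so that both carry z^(j+1)
   tau^(s-j). The end terms z^(s+1) and tau^(s+1) split off and the rest combines by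
   [gauss_pascal]. *)
pose F j := gauss Q j (s - j) * (- d) ^+ (s - j) * monom Q j.+1 (s - j) X n.
pose G j := Q ^+ j.+1 * (gauss Q j.+1 (s - j.+1) * (- d) ^+ (s - j.+1)
  * monom Q j.+1 (s - j.+1).+1 X n).
transitivity (\sum_(j < s) (F j + - d * G j) + monom Q s.+1 0 X n
    - d * ((- d) ^+ s * monom Q 0 s.+1 X n)).
  rewrite big_split /= -mulr_sumr big_ord_recr big_ord_recl /=.
  rewrite subnn gaussn0 // subn0 gauss0n // !mul1r -/(F _).
  rewrite [X in _ * (_ + X)](_ : _ = \sum_(j < s) G j) //.
  by rewrite -[X in X + _ + _ = _]/(\sum_(j < s) F j); ring.
rewrite [RHS]big_ord_recl big_ord_recr /= subn0 gauss0n // subnn gaussn0 //.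
rewrite !mul1r exprS mulrA [RHS]addrC; congr (_ + _); last by ring.
congr (_ + _); apply: eq_bigr => j _.
rewrite /F /G /bump leq0n add1n subSS.
have -> : (s - j)%N = (s - j.+1).+1 by rewrite subnSK.
rewrite -[delay _ n]/(monom Q j.+1 _ X n).
by rewrite gauss_pascal // [(- d) ^+ _.+1]exprS; ring.
Qed.

(** * Elementary symmetric polynomials of the parameters *)

Fixpoint esym ys : nat -> K :=
  if ys is y :: ys' then addz y (esym ys') (delay (esym ys'))
  else fun s => (s == 0%N)%:R.

Lemma esym0 ys : esym ys 0 = 1.
Proof. by elim: ys => //= y ys IH; rewrite /addz /= mulr0 addr0. Qed.

Lemma esym_gt ys s : (size ys < s)%N -> esym ys s = 0.
Proof.
elim: ys s => [|y ys IH] [|s] //=; rewrite ltnS => sys.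
by rewrite /addz /= !IH ?mulr0 ?addr0 // ltnW.
Qed.

(** Multiplication of E by 1 + yX, with the powers X^s replaced by arbitrary values [F s]. It serves
    both for scalars ([esym_prod]) and for powers of u ([eop_sum]). *)
Lemma esym_cons_sum y ys (F : nat -> K) :
  \sum_(s < (size (y :: ys)).+1) esym (y :: ys) s * F s =
  \sum_(s < (size ys).+1) esym ys s * F s
  + y * \sum_(s < (size ys).+1) esym ys s * F s.+1.
Proof.
rewrite /= /addz mulr_sumr.
under eq_bigr => s _ do rewrite mulrDl.
rewrite big_split /=; congr (_ + _).
  by rewrite big_ord_recr /= esym_gt // mul0r addr0.
rewrite big_ord_recl /= mulr0 mul0r add0r.
by apply: eq_bigr => s _; rewrite /= mulrA.
Qed.

Lemma esym_prod ys (t : K) :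
  \sum_(s < (size ys).+1) esym ys s * t ^+ s = \prod_(y <- ys) (1 + y * t).
Proof.
elim: ys => [|y ys IH]; first by rewrite big_ord1 big_nil mulr1.
rewrite esym_cons_sum big_cons -IH.
under [X in _ + _ * X = _]eq_bigr => s _ do rewrite exprS mulrCA.
by rewrite -mulr_sumr; ring.
Qed.

Lemma uop_sum d Q (c : nat -> K) (Y : nat -> nat -> K) m n :
  uop d Q (fun k => \sum_(s < m) c s * Y s k) n
  = \sum_(s < m) c s * uop d Q (Y s) n.
Proof.
rewrite /uop /addz /dilate !mulr_sumr.
have -> : delay (fun k => \sum_(s < m) c s * Y s k) n
        = \sum_(s < m) c s * delay (Y s) n.
  by case: n => //=; rewrite big1 // => s _; rewrite mulr0.
by rewrite -big_split /=; apply: eq_bigr => s _; ring.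
Qed.

Lemma eop_sum d Q ys X n :
  eop d Q ys X n = \sum_(s < (size ys).+1) esym ys s * iter s (uop d Q) X n.
Proof.
elim: ys n => [|y ys IH] n; first by rewrite big_ord1 mul1r.
rewrite (esym_cons_sum y ys (fun s => iter s (uop d Q) X n)) [LHS]/=.
have -> : eop d Q ys X = fun k =>
    \sum_(s < (size ys).+1) esym ys s * iter s (uop d Q) X k by exact/funext.
by rewrite /addz uop_sum.
Qed.

Lemma hop_sum d Q ys X n :
  hop d Q ys X n = \sum_(s < size ys) esym ys s.+1 * iter s (uop d Q) X n.
Proof.
elim: ys n => [|y ys IH] n /=; first by rewrite big_ord0.
have -> : hop d Q ys X = fun k =>
    \sum_(s < size ys) esym ys s.+1 * iter s (uop d Q) X k by exact/funext.
rewrite /addz (uop_sum d Q (fun s => esym ys s.+1)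
  (fun s => iter s (uop d Q) X)) /=.
under [RHS]eq_bigr => s _ do rewrite mulrDl -mulrA.
rewrite big_split /= big_ord_recr /= esym_gt // mul0r addr0 -addrA.
by rewrite -mulr_sumr big_ord_recl /= esym0 mul1r mulrDr [X in _ = _ + X]addrC.
Qed.

(** * From the operator equation to the scalar recurrence *)

Lemma triangular_sum r (F : nat -> nat -> K) :
  \sum_(s < r) \sum_(j < s.+1) F j (s - j)%N =
  \sum_(j < r) \sum_(m < r - j) F j m.
Proof.
elim: r => [|r IH]; first by rewrite !big_ord0.
rewrite big_ord_recr /= IH !big_ord_recr /= subSnn subnn big_ord1.
rewrite addrA; congr (_ + _); rewrite -big_split /=; apply: eq_bigr => j _.
by rewrite subSn 1?ltnW // big_ord_recr.
Qed.

(** The coefficient sum of the given equation, with e_(j+m) in place of the sums of q^alpha. The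
    value 0 at m = 0 stands for the q-binomial coefficient with lower index -1. The index j = 0
    yields the diagonal term, see [qcoef0]. *)
Definition qcoef d Q ys j (x : K) :=
  \sum_(m < (size ys - j).+1) d ^+ m * (esym ys (j + m) * x *
    ((if nat_of_ord m is m'.+1 then (- x) ^+ m' * gauss Q j m' else 0)
     + (- x) ^+ m * gauss Q j m)).

(** Extracts the n-th terms in [sol_eq]: [iter_uop] puts E(u) and H(u) in normal order, and z^j
    tau^m tau contributes x^(m+1) w_(n-j) with x = Q^(n-j). *)
Lemma sol_rec d Q ys n :
  (forall n, 1 - Q ^+ n.+1 != 0) ->
  (forall y, y \in ys -> forall n, 1 - d * y * Q ^+ n != 0) ->
  sol d Q ys n - delay (sol d Q ys) n =
  \sum_(j < (size ys).+1) (if (j <= n)%N then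
      qcoef d Q ys j (Q ^+ (n - j)) * sol d Q ys (n - j)%N else 0).
Proof.
move=> Q1 yQ; have /(congr1 (fun F => F n)) := sol_eq Q1 yQ.
set W := sol d Q ys; rewrite /addz mulN1r => <-.
pose F j m := esym ys (j + m) * (gauss Q j m * (- d) ^+ m
  * monom Q j m (dilate Q W) n).
pose G j m := esym ys (j + m).+1 * (gauss Q j m * (- d) ^+ m
  * monom Q j m (dilate Q W) n).
have -> : eop d Q ys (dilate Q W) n
    = \sum_(s < (size ys).+1) \sum_(j < s.+1) F j (s - j)%N.
  rewrite eop_sum; apply: eq_bigr => s _; rewrite iter_uop // mulr_sumr.
  by apply: eq_bigr => j _; rewrite /F subnKC // -ltnS.
have -> : hop d Q ys (dilate Q W) n
    = \sum_(s < size ys) \sum_(j < s.+1) G j (s - j)%N.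
  rewrite hop_sum; apply: eq_bigr => s _; rewrite iter_uop // mulr_sumr.
  by apply: eq_bigr => j _; rewrite /G subnKC // -ltnS.
rewrite !triangular_sum.
have -> : \sum_(j < size ys) \sum_(m < size ys - j) G j m
    = \sum_(j < (size ys).+1) \sum_(m < size ys - j) G j m.
  by rewrite [RHS]big_ord_recr /= subnn big_ord0 addr0.
rewrite mulr_sumr -big_split /=; apply: eq_bigr => j _.
rewrite subSn; last by rewrite -ltnS.
rewrite /F /G mulr_sumr.
case: leqP => jn; last first.
  by rewrite !big1 ?addr0 // => m _; rewrite monomE leqNgt jn !mulr0.
rewrite /qcoef mulr_suml.
under eq_bigr do rewrite monomE jn.
under [X in _ + X]eq_bigr do rewrite monomE jn.
rewrite /dilate; move: (Q ^+ (n - j)) (W (n - j)%N) => x w.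
rewrite [RHS](eq_bigr (fun m : 'I_(size ys - j).+1 =>
   d ^+ m * esym ys (j + m) * x *
   (if nat_of_ord m is m'.+1 then (- x) ^+ m' * gauss Q j m' else 0) * w
   + d ^+ m * esym ys (j + m) * x * ((- x) ^+ m * gauss Q j m) * w)); last first.
  by move=> m _; rewrite !mulrDr mulrDl !mulrA.
(* E(u) yields the second terms of [qcoef]; d H(u) yields the first ones with m shifted by one,
   which leaves 0 at m = 0. *)
rewrite big_split /= [RHS]addrC; congr (_ + _).
  apply: eq_bigr => m _.
  by rewrite -[- d]mulN1r -[- x]mulN1r !exprMn; ring.
rewrite [RHS]big_ord_recl /= mulr0 mul0r add0r; apply: eq_bigr => m _.
rewrite /bump leq0n add1n addnS exprS.
by rewrite -[- d]mulN1r -[- x]mulN1r !exprMn; ring.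
Qed.

(** For j = 0 all q-binomial coefficients are 1, so the summand is x at m = 0 and -(1 - x) e_m
    (-dx)^m for m > 0; what remains is (1 - x) E(-dx). *)
Lemma qcoef0 d Q ys x : (forall n, 1 - Q ^+ n.+1 != 0) ->
  1 - qcoef d Q ys 0 x = (1 - x) * \prod_(y <- ys) (1 - d * y * x).
Proof.
move=> Q1; have -> : \prod_(y <- ys) (1 - d * y * x)
    = \sum_(s < (size ys).+1) esym ys s * (- (d * x)) ^+ s.
  by rewrite esym_prod; apply: eq_bigr => y _; ring.
rewrite /qcoef subn0 !big_ord_recl /= add0n esym0 gauss0n //.
rewrite [RHS]mulrDr [in RHS]mulr_sumr.
have -> : \sum_(i < size ys) d ^+ bump 0 i * (esym ys (0 + bump 0 i) * x *
       ((- x) ^+ i * gauss Q 0 i + (- x) ^+ bump 0 i * gauss Q 0 (bump 0 i)))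
  = - \sum_(i < size ys) (1 - x) *
      (esym ys (bump 0 i) * (- (d * x)) ^+ bump 0 i).
  rewrite -sumrN; apply: eq_bigr => i _; rewrite !gauss0n // add0n.
  by rewrite /bump leq0n add1n -(mulrN d x) exprMn [(- x) ^+ _.+1]exprS; ring.
by ring.
Qed.

(** The full coefficient of f(xQ^j); the Kronecker symbol accounts for the separate term f(xq^N). *)
Definition bcoef d Q ys j x :=
  (j == 1%N)%:R + qcoef d Q ys j x * \prod_(1 <= h < j) (1 - x * Q ^+ h).

Definition adj d Q ys n := qpoch Q Q n * sol d Q ys n.

Lemma sol0 d Q ys : sol d Q ys 0 = \prod_(y <- ys) (1 - d * y)^-1.
Proof.
elim: ys => [|y ys IH] /=; first by rewrite qpoch0 invr1 big_nil.
rewrite /twist qpochS qpoch0 /convol big_ord1 subnn euler0 /addz /=.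
by rewrite big_cons IH expr0 mulr0 addr0 mul1r mulr1 mul1r.
Qed.

Lemma qpochD Q m n :
  qpoch Q Q (m + n) = qpoch Q Q m * \prod_(1 <= h < n.+1) (1 - Q ^+ m * Q ^+ h).
Proof.
elim: n => [|n IH]; first by rewrite addn0 big_geq // mulr1.
rewrite addnS qpochS IH [in RHS]big_nat_recr //= mulrA; congr (_ * (1 - _)).
by rewrite -exprD -exprS addnS.
Qed.

(** Multiply [sol_rec] by (Q;Q)_(n-1). The factor 1 - Q^n of [qcoef0] completes (Q;Q)_n on the left,
    the quotients (Q;Q)_(n-1)/(Q;Q)_(n-j) are the products in [bcoef], and w_(n-1) gives its
    Kronecker symbol. *)
Lemma adj_rec d Q ys n :
  (forall n, 1 - Q ^+ n.+1 != 0) ->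
  (forall y, y \in ys -> forall n, 1 - d * y * Q ^+ n != 0) ->
  (0 < size ys)%N ->
  \prod_(y <- ys) (1 - d * y * Q ^+ n) * adj d Q ys n = (n == 0%N)%:R +
  \sum_(1 <= j < (size ys).+1) (if (j <= n)%N then
      bcoef d Q ys j (Q ^+ (n - j)) * adj d Q ys (n - j)%N else 0).
Proof.
move=> Q1 yQ ys0; have Q1' m : 1 - Q * Q ^+ m != 0 by rewrite -exprS.
(* At n = 0 [sol_rec] carries no information, as 1 - Q^0 = 0; the initial value comes from
   [sol0]. *)
case: n => [|n].
  rewrite eqxx /adj qpoch0 mul1r sol0 -big_split /= big1_seq; last first.
    move=> y /andP[_ yys]; rewrite expr0 mulr1 divff //.
    by have := yQ _ yys 0%N; rewrite expr0 mulr1.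
  by rewrite big1_seq ?addr0 // => j /andP[_]; rewrite mem_index_iota; case: j.
rewrite add0r.
have := sol_rec n.+1 Q1 yQ; set W := sol d Q ys.
rewrite big_ord_recl /= subn0 => H.
have {}H : (1 - qcoef d Q ys 0 (Q ^+ n.+1)) * W n.+1 = W n +
   \sum_(1 <= j < (size ys).+1) (if (j <= n.+1)%N then
      qcoef d Q ys j (Q ^+ (n.+1 - j)) * W (n.+1 - j)%N else 0).
  rewrite big_add1 /= big_mkord -[X in _ = _ + X](addKr
    (qcoef d Q ys 0 (Q ^+ n.+1) * W n.+1)) -H; ring.
rewrite qcoef0 // in H.
rewrite /adj qpochS -exprS -/W.
set P := \prod_(y <- ys) _ in H *.
have -> : P * (qpoch Q Q n * (1 - Q ^+ n.+1) * W n.+1)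
  = qpoch Q Q n * ((1 - Q ^+ n.+1) * P * W n.+1) by ring.
rewrite H mulrDr.
rewrite [in RHS]big_ltn // [in LHS]big_ltn //.
rewrite /= subSS subn0 {1}/bcoef [\prod_(1 <= h < 1) _]big_geq // mulr1.
rewrite mulrDl mul1r.
rewrite mulrDr !addrA; congr (_ + _ + _); first by ring.
rewrite mulr_sumr; apply: eq_big_nat => j /andP[j1 _].
case: leqP => jn; last by rewrite mulr0.
rewrite /bcoef gtn_eqF // add0r.
case: j j1 jn => [|j] // _; rewrite ltnS => jn.
rewrite subSS -{1}(subnK jn) qpochD; ring.
Qed.

(** Summation by parts: both recurrences evaluate the sum of p_n u_n v_n over n < r + M. The
    products B_j(n) v_n u_(n+j) with n + j < r + M cancel, and those with n < r + M <= n + j remain.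
    Since j <= r, the subtraction in r + M + i - j is exact. *)
Lemma pairing r (p u v : nat -> K) (B : nat -> nat -> K) M : (0 < r)%N ->
  (forall n, p n * u n = \sum_(1 <= j < r.+1) B j n * u (n + j)%N) ->
  (forall n, p n * v n = (n == 0%N)%:R + \sum_(1 <= j < r.+1)
     (if (j <= n)%N then B j (n - j)%N * v (n - j)%N else 0)) ->
  u 0 = \sum_(1 <= j < r.+1) \sum_(0 <= i < j)
     let n := (r + M + i - j)%N in B j n * v n * u (n + j)%N.
Proof.
move=> r0 pu pv; have rM : (0 < r + M)%N by rewrite ltn_addr.
pose G j n := B j n * v n * u (n + j)%N.
have A : \sum_(0 <= n < r + M) \sum_(1 <= j < r.+1) G j n
    = u 0 + \sum_(0 <= n < r + M) \sum_(1 <= j < r.+1)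
        (if (j <= n)%N then G j (n - j)%N else 0).
  transitivity (\sum_(0 <= n < r + M) v n * (p n * u n)).
    apply: eq_bigr => n _; rewrite pu mulr_sumr; apply: eq_bigr => j _.
    by rewrite /G; ring.
  transitivity (\sum_(0 <= n < r + M) ((n == 0%N)%:R * u n + \sum_(1 <= j < r.+1)
        (if (j <= n)%N then G j (n - j)%N else 0))).
    apply: eq_bigr => n _; rewrite mulrCA mulrA pv mulrDl; congr (_ + _).
    rewrite mulr_suml; apply: eq_bigr => j _.
    by case: leqP => jn; rewrite ?mul0r // /G subnK.
  rewrite big_split /=; congr (_ + _).
  rewrite big_ltn // eqxx mul1r big1_seq ?addr0 // => n /andP[_].
  by rewrite mem_index_iota; case: n => // n _; rewrite mul0r.
rewrite -[u 0](addrK (\sum_(0 <= n < r + M) \sum_(1 <= j < r.+1)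
        (if (j <= n)%N then G j (n - j)%N else 0))) -A.
rewrite exchange_big [X in _ - X]exchange_big -sumrB /=.
apply: eq_big_nat => j /andP[j1 jr].
have jrM : (j <= r + M)%N by rewrite ltnS in jr;
  exact: leq_trans jr (leq_addr _ _).
have -> : \sum_(0 <= n < r + M) (if (j <= n)%N then G j (n - j)%N else 0)
    = \sum_(0 <= n < r + M - j) G j n.
  rewrite (big_cat_nat (n := j)) //= big_nat big1 => [|n /andP[_ nj]]; last first.
    by rewrite leqNgt nj.
  rewrite add0r -{1}[j]add0n big_addn.
  by apply: eq_bigr => n _; rewrite leq_addl addnK.
rewrite [X in X - _](big_cat_nat (n := (r + M - j)%N)) ?leq_subr //=.
rewrite [LHS]addrC addKr -{1}[(r + M - j)%N]add0n big_addn subKn //.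
by apply: eq_bigr => i _; rewrite addnBA // [(i + _)%N]addnC.
Qed.

(** * Convolution with the Euler series *)

Lemma euler_mulQ Q y n : euler Q (y * Q) n = Q ^+ n * euler Q y n.
Proof.
elim: n => [|n IH]; first by rewrite !euler0 mulr1.
by rewrite !eulerS IH [Q ^+ n.+1]exprS; ring.
Qed.

(** On generating series this is (1 + yz)(-yQz;Q)_oo = (-yz;Q)_oo. *)
Lemma convol_euler Q y X : (forall n, 1 - Q ^+ n.+1 != 0) ->
  convol (euler Q (y * Q)) (addz y X (delay X)) = convol (euler Q y) X.
Proof.
move=> Q1; rewrite convol_addz -delay_convol; apply/funext => -[|n].
  by rewrite /addz /= mulr0 addr0 /convol !big_ord1 !euler0.
rewrite /addz /= /convol big_ord_recl [RHS]big_ord_recl !euler0 -addrA.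
congr (_ + _); rewrite mulr_sumr -big_split /=; apply: eq_bigr => k _.
rewrite /bump leq0n add1n subSS mulrA -mulrDl; congr (_ * _).
rewrite !euler_mulQ !eulerS; move: (Q1 k); rewrite exprS.
by move: (euler Q y k) (Q ^+ k) => e x x1; field.
Qed.

(** For d = 0 and the single parameter y the adjoint recurrence is v_(n+1) = (1 + yQ^n) v_n, so it
    evaluates the convolution as a finite product. *)
Lemma q_binomial Q y n : (forall n, 1 - Q ^+ n.+1 != 0) ->
  qpoch Q Q n * convol (euler Q y) (fun m => (qpoch Q Q m)^-1) n
  = qpoch Q (- y) n.
Proof.
move=> Q1.
have q0 m : qpoch Q (0 * y) m = 1.
  by rewrite /qpoch big1 // => i _; rewrite !mul0r subr0.
have adjE m : adj 0 Q [:: y] m =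
    qpoch Q Q m * convol (euler Q y) (fun k => (qpoch Q Q k)^-1) m.
  by rewrite /adj /= /twist convol_euler // q0 invr1 mul1r.
rewrite -adjE; elim: n => [|n IH].
  by rewrite adjE !qpoch0 /convol big_ord1 euler0 qpoch0 invr1 !mulr1.
have := @adj_rec 0 Q [:: y] n.+1 Q1.
rewrite big_seq1 !mul0r subr0 mul1r /= add0r => -> //; last first.
  by move=> z _ m; rewrite !mul0r subr0 oner_neq0.
rewrite big_nat1 /= subSS subn0 IH qpochS mulrC /bcoef /= big_geq // mulr1.
rewrite /qcoef /= big_ord1 /= gaussn0 // /addz /=; ring.
Qed.

End Operators.

(** * The coefficients of the q-difference equation *)

(** For k = 1 the sum is empty, and positivity propagates by strong induction. *)
Lemma superincreasing_gt0 (a : nat -> int) (r : nat) :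
  (forall k : nat, (1 <= k <= r)%N -> \sum_(1 <= i < k) a i < a k) ->
  forall k, (1 <= k <= r)%N -> 0 < a k.
Proof.
move=> grow; elim/ltn_ind => k IH kr; apply: le_lt_trans (grow k kr).
rewrite big_nat; apply: sumr_ge0 => i /andP[i1 ik].
by rewrite ltW // IH // i1 (leq_trans (ltnW ik)) //; case/andP: kr.
Qed.

(** Distinctness of the sums makes [undup] harmless, so sums over A' become sums over nonempty index
    sets. *)
Lemma perm_sums (a : nat -> int) (r : nat) : nonempty_sums_distinct a r ->
  perm_eq (sums a r) [seq subset_sum a B | B : {set 'I_r} in
                     [pred B : {set 'I_r} | B != finset.set0]].
Proof.
move=> inj; rewrite /sums perm_sort undup_id //.
rewrite map_inj_in_uniq ?enum_uniq // => B C; rewrite !mem_enum !inE.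
exact: inj.
Qed.

Lemma size_sums (a : nat -> int) (r : nat) : nonempty_sums_distinct a r ->
  size (sums a r) = (2 ^ r - 1)%N.
Proof.
move=> inj; rewrite (perm_size (perm_sums inj)) size_map -cardE.
have card2 : #|{: {set 'I_r}}| = (2 ^ r)%N.
  by rewrite -cardsT -powersetT card_powerset cardsT card_ord.
by rewrite -card2 -(cardC (pred1 (finset.set0 : {set 'I_r}))) card1 addKn.
Qed.

(** By [size_sums], alpha(2^r - 1) is the last entry of the sorted sequence. *)
Lemma sums_le_alpha (a : nat -> int) (r : nat) s : nonempty_sums_distinct a r ->
  s \in sums a r -> s <= alpha a r (2 ^ r - 1)%N.
Proof.
move=> inj ss; rewrite /alpha -(size_sums inj).
have so : sorted <=%R (sums a r) by apply: sort_sorted; exact: le_total.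
rewrite -{1}(nth_index 0 ss); apply: (le_sorted_leq_nth _ so).
- by rewrite inE index_mem.
- by rewrite inE prednK //; case: (sums a r) ss.
- by rewrite -ltnS prednK ?index_mem //; case: (sums a r) ss.
Qed.

Lemma weight_subset_sum (a : nat -> int) (r : nat) (B : {set 'I_r}) :
  nonempty_sums_distinct a r -> B != finset.set0 ->
  weight a r (subset_sum a B) = #|B|.
Proof.
move=> inj B0; rewrite /weight; case: pickP => [C /andP[C0 /eqP]|/(_ B)].
  by move/inj => ->.
by rewrite B0 eqxx.
Qed.

Section Coefficients.
Context {K : fieldType}.
Implicit Types (q x d Q : K).

Lemma esym_coef (ys : seq K) s :
  (\prod_(y <- ys) (y *: 'X + 1))`_s = esym ys s.
Proof.
elim: ys s => [|y ys IH] s; first by rewrite big_nil coef1.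
rewrite big_cons mulrDl mul1r coefD addrC /= /addz IH; congr (_ + _).
by rewrite -scalerAl coefZ coefXM; case: s => //= s; rewrite IH.
Qed.

(** Expanding the product of the y_i X + 1 chooses a set of indices, whose cardinal is the degree of
    the term. *)
Lemma esym_subsets r (y : 'I_r -> K) s :
  esym [seq y i | i <- enum 'I_r] s
  = \sum_(B : {set 'I_r} | #|B| == s) \prod_(i in B) y i.
Proof.
rewrite -esym_coef big_map big_enum /= bigA_distr coef_sum [RHS]big_mkcond /=.
apply: eq_bigr => B _; rewrite -big_mkcond /= scaler_prod coefZ prodr_const.
by rewrite coefXn eq_sym; case: eqP => _; rewrite ?mulr1 ?mulr0.
Qed.

(** The exponents are positive, so they can be treated as natural numbers; integer powers need not
    be additive at q = 0. *)
Lemma exprz_subset_sum (a : nat -> int) r q (B : {set 'I_r}) :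
  (forall k, (1 <= k <= r)%N -> 0 < a k) ->
  q ^ subset_sum a B = \prod_(i in B) q ^ a i.+1.
Proof.
move=> a0; have aE (i : 'I_r) : a i.+1 = `|a i.+1|%N%:Z.
  by rewrite gez0_abs // ltW // a0 //=.
rewrite /subset_sum (eq_bigr _ (fun i _ => aE i)).
rewrite -(big_morph Posz PoszD (erefl 0%:Z)) -exprnP expr_sum.
by apply: eq_bigr => i _; rewrite [in RHS]aE.
Qed.

Lemma qbinom_gauss Q j m : (forall n, 1 - Q ^+ n.+1 != 0) ->
  qbinom Q (j%:Z + m%:Z) m%:Z = gauss Q j m.
Proof.
move=> Q1; rewrite /qbinom lez_nat leq0n -PoszD lez_nat leq_addl /=.
rewrite /gauss qpochD.
have -> : \prod_(0 <= i < m) (1 - Q ^ ((j + m)%:Z - i%:Z))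
  = \prod_(1 <= h < m.+1) (1 - Q ^+ j * Q ^+ h).
  rewrite big_add1 /= big_nat_rev /=; apply: eq_big_nat => i /andP[_ im].
  rewrite add0n -exprD subzn; last first.
    by rewrite (leq_trans (leq_subr _ _)) // leq_addl.
  congr (1 - _ ^+ _); rewrite -addnBA ?leq_subr // subKn //.
have -> : \prod_(1 <= i < m.+1) (1 - Q ^+ i) = qpoch Q Q m.
  by rewrite /qpoch big_add1; apply: eq_bigr => i _; rewrite exprS.
rewrite invfM mulrACA divff ?mul1r //.
by apply: qpoch_neq0 => n; rewrite -exprS.
Qed.

(** All of A' lies below a(r+1), so the inner sum ranges over every index set with j + m elements
    and produces e_(j+m). *)
Lemma qdiff_coefE (a : nat -> int) r (N : nat) d q j x :
  nonempty_sums_distinct a r ->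
  (forall k, (1 <= k <= r)%N -> 0 < a k) ->
  (forall s, s \in sums a r -> s < a r.+1) ->
  (forall n, 1 - (q ^+ N) ^+ n.+1 != 0) -> (0 < j)%N ->
  qdiff_coef a r N d q j x
  = qcoef d (q ^+ N) [seq q ^ a i.+1 | i : 'I_r] j x.
Proof.
move=> inj a0 sa Q1 j0; rewrite /qdiff_coef /qcoef size_map size_enum_ord.
rewrite big_mkord; apply: eq_bigr => m _; congr (_ * _).
rewrite esym_subsets -mulrA mulr_suml.
set c := (X in _ = \sum_(_ | _) _ * (x * X)).
have -> : ((- x) ^ (m%:Z - 1) * qbinom (q ^ N) (j%:Z + m%:Z - 1) (m%:Z - 1)
       + (- x) ^+ m * qbinom (q ^ N) (j%:Z + m%:Z) m%:Z) = c.
  rewrite /c qbinom_gauss //; congr (_ + _).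
  (* At m = 0 the lower index of the q-binomial coefficient is -1, which matches the 0 in
     [qcoef]. *)
  case: (nat_of_ord m) => [|m'].
    by rewrite /qbinom /= mulr0.
  rewrite -addrA [m'.+1%:Z]intS [1 + _]addrC addrK.
  by rewrite qbinom_gauss.
rewrite big_seq_cond.
under eq_bigl => s.
  rewrite andbA (_ : (s \in _) && _ = (s \in sums a r)); last first.
    by apply/idP/idP => [/andP[]//|ss]; rewrite ss sa.
  over.
rewrite -big_seq_cond (perm_big _ (perm_sums inj)) /= big_map big_enum_cond /=.
apply: eq_big => [B|B /andP[B0 _]].
  rewrite inE; case: eqVneq => [->|B0] /=.
    (* The empty set, absent from A', does not have j + m elements since j > 0. *)
    by rewrite cards0 eq_sym addn_eq0 eqn0Ngt j0.
  by rewrite weight_subset_sum.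
by rewrite exprz_subset_sum //; ring.
Qed.

End Coefficients.

(** * Limits *)

Section Limits.
Context {R : realType}.
Local Notation C := R[i].
Local Notation nc := (@Normc.normc R).
Implicit Types (u v : nat -> C) (z l c d Q y : C) (rho : R).

Lemma normc_ge0 z : 0 <= nc z.
Proof. by rewrite -ler0c; exact: (normr_ge0 z). Qed.

Lemma normcX z n : nc (z ^+ n) = nc z ^+ n.
Proof. by elim: n => [|n IH]; rewrite ?Normc.normc1 // !exprS Normc.normcM IH. Qed.

Lemma normc_sum n (F : 'I_n -> C) :
  nc (\sum_(k < n) F k) <= \sum_(k < n) nc (F k).
Proof.
apply: (big_ind2 (fun z (x : R) => nc z <= x)) => //.
  by rewrite Normc.normc0.
by move=> z x w y zx wy; apply: le_trans (le_normcD _ _) _; exact: lerD.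
Qed.

(** The radii in [C^o] are positive complex numbers, hence real, so convergence can be tested on the
    real-valued modulus. *)
Lemma cvgC_normP u l :
  (u : nat -> C^o) @ \oo --> (l : C^o) <->
  nc (u n - l) @[n --> \oo] --> (0 : R).
Proof.
split=> [/cvgrPdist_lt ul|/cvgrPdist_lt ul].
  apply/cvgrPdist_lt => e e0.
  have eC : 0 < e%:C by rewrite ltcR.
  apply: filterS (ul _ eC) => n /=; rewrite distrC => ul_e.
  by rewrite sub0r normrN ger0_norm ?normc_ge0 // -ltcR.
apply/cvgrPdist_lt => e e0.
have eE : e = (complex.Re e)%:C by rewrite RRe_real // gtr0_real.
have eR : 0 < complex.Re e by rewrite -ltcR -eE.
apply: filterS (ul _ eR) => n /=.
rewrite sub0r normrN ger0_norm ?normc_ge0 // -ltcR => ul_e.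
by rewrite distrC eE.
Qed.

Lemma cvgC_le u l (b : nat -> R) : (forall n, nc (u n - l) <= b n) ->
  b @ \oo --> (0 : R) -> (u : nat -> C^o) @ \oo --> (l : C^o).
Proof.
move=> ub b0; apply/cvgC_normP.
apply: (@squeeze_cvgr _ _ _ _ (fun=> 0) b) => //; last exact: cvg_cst.
by apply: nearW => n; rewrite normc_ge0 ub.
Qed.

(** The telescoping series is dominated by a geometric one. *)
Lemma cvg_geometric_step (u : nat -> R) (M rho : R) : 0 <= rho < 1 -> 0 <= M ->
  (forall n, `|u n.+1 - u n| <= M * rho ^+ n) -> cvgn u.
Proof.
move=> /andP[rho0 rho1] M0 uM.
have -> : u = (fun n => u 0%N + series (telescope u) n).
  by apply/funext => n; rewrite -eq_sum_telescope.
apply: is_cvgD; first exact: is_cvg_cst.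
apply: normed_cvg; apply: (@series_le_cvg _ _ (geometric M rho)).
- by move=> n; exact: normr_ge0.
- by move=> n; rewrite /geometric /= mulr_ge0 // exprn_ge0.
- by move=> n; exact: uM.
- by apply: is_cvg_geometric_series; rewrite ger0_norm.
Qed.

Lemma normr_Re_le z : `|complex.Re z| <= nc z.
Proof. by rewrite -lecR; exact: normc_ge_Re. Qed.

Lemma normr_Im_le z : `|complex.Im z| <= nc z.
Proof.
rewrite -normrN -ReiNIm; apply: le_trans (normr_Re_le _) _.
by rewrite Normc.normcM /= expr0n /= add0r expr1n sqrtr1 mulr1.
Qed.

Lemma normc_le_ReIm z : nc z <= `|complex.Re z| + `|complex.Im z|.
Proof.
rewrite [z in nc z]complexE; apply: le_trans (le_normcD _ _) _.
rewrite Normc.normcM /= !expr0n /= !addr0 add0r expr1n sqrtr1 mul1r.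
by rewrite !sqrtr_sqr.
Qed.

Lemma cvgC_geometric_step u (M rho : R) : 0 <= rho < 1 -> 0 <= M ->
  (forall n, nc (u n.+1 - u n) <= M * rho ^+ n) ->
  exists l, (u : nat -> C^o) @ \oo --> (l : C^o).
Proof.
move=> rho01 M0 uM.
have ReB (x y : C) : complex.Re (x - y) = complex.Re x - complex.Re y.
  by case: x; case: y.
have ImB (x y : C) : complex.Im (x - y) = complex.Im x - complex.Im y.
  by case: x; case: y.
have /cvg_ex[a ua] : cvgn (fun n => complex.Re (u n)).
  apply: (cvg_geometric_step rho01 M0) => n; rewrite -ReB.
  exact: le_trans (normr_Re_le _) (uM n).
have /cvg_ex[b ub] : cvgn (fun n => complex.Im (u n)).
  apply: (cvg_geometric_step rho01 M0) => n; rewrite -ImB.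
  exact: le_trans (normr_Im_le _) (uM n).
exists (a +i* b).
apply: (@cvgC_le _ _
  (fun n => `|complex.Re (u n) - a| + `|complex.Im (u n) - b|)).
  by move=> n; have := normc_le_ReIm (u n - (a +i* b)); rewrite ReB ImB.
rewrite -(addr0 0); apply: cvgD.
  rewrite -(normr0 R) -(subrr a); apply: cvg_norm.
  by apply: cvgB => //; exact: cvg_cst.
rewrite -(normr0 R) -(subrr b); apply: cvg_norm.
  by apply: cvgB => //; exact: cvg_cst.
Qed.

Lemma prod_le_expR (c rho : R) n : 0 <= c -> 0 <= rho < 1 ->
  \prod_(0 <= j < n) (1 + c * rho ^+ j) <= expR (c / (1 - rho)).
Proof.
move=> c0 /andP[rho0 rho1]; have r1 : 0 < 1 - rho by rewrite subr_gt0.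
(* The partial geometric sum in the exponent makes the induction go through; each step is 1 + t <=
   exp t. *)
apply: (@le_trans _ _ (expR (c * (1 - rho ^+ n) / (1 - rho)))); last first.
  rewrite ler_expR ler_pM2r ?invr_gt0 // ler_piMr // gerBl exprn_ge0 //.
elim: n => [|n IH]; first by rewrite big_geq // expr0 subrr mulr0 mul0r expR0.
rewrite big_nat_recr //=.
have -> : c * (1 - rho ^+ n.+1) / (1 - rho)
    = c * (1 - rho ^+ n) / (1 - rho) + c * rho ^+ n.
  by rewrite exprS; field; rewrite gt_eqF.
rewrite expRD; apply: ler_pM => //; last exact: expR_ge1Dx.
- by apply: prodr_ge0 => j _; rewrite addr_ge0 // mulr_ge0 // exprn_ge0.
- by rewrite addr_ge0 // mulr_ge0 // exprn_ge0.
Qed.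

(** * Infinite q-shifted factorials *)

Lemma normc_qpoch (Q c : C) n :
  nc (qpoch Q c n) = \prod_(0 <= j < n) nc (1 - c * Q ^+ j).
Proof.
elim: n => [|n IH]; first by rewrite qpoch0 big_geq // Normc.normc1.
by rewrite qpochS Normc.normcM IH big_nat_recr.
Qed.

Lemma qpoch_bounded (Q c : C) : nc Q < 1 ->
  exists2 M : R, 0 < M & forall n, nc (qpoch Q c n) <= M.
Proof.
move=> Q1; exists (expR (nc c / (1 - nc Q))); first exact: expR_gt0.
move=> n; apply: le_trans (prod_le_expR n (normc_ge0 c) _); last first.
  by rewrite normc_ge0.
rewrite normc_qpoch; apply: ler_prod => j _; rewrite normc_ge0 /=.
apply: le_trans (le_normcD _ _) _.
by rewrite normcN Normc.normc1 Normc.normcM normcX.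
Qed.

(** With t = |Q|^j, |1 - cQ^j|^-1 <= 1/(1 - |c|t) <= 1 + |c|t/(1 - |c|), so [prod_le_expR] applies
    with the constant |c|/(1 - |c|). *)
Lemma qpoch_inv_bounded (Q c : C) : nc Q < 1 -> nc c < 1 ->
  exists2 M : R, 0 < M & forall n, (nc (qpoch Q c n))^-1 <= M.
Proof.
move=> Q1 c1; exists (expR (nc c / (1 - nc c) / (1 - nc Q))).
  exact: expR_gt0.
have c1' : 0 < 1 - nc c by rewrite subr_gt0.
have cc0 : 0 <= nc c / (1 - nc c) by rewrite divr_ge0 ?normc_ge0 // ltW.
move=> n; apply: le_trans (prod_le_expR n cc0 _); last by rewrite normc_ge0.
rewrite normc_qpoch -prodfV; apply: ler_prod => j _.
rewrite invr_ge0 normc_ge0 /=.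
have Qj : nc Q ^+ j <= 1 by rewrite exprn_ile1 ?normc_ge0 // ltW.
have Qj0 : 0 <= nc Q ^+ j by rewrite exprn_ge0 // normc_ge0.
have low : 1 - nc c * nc Q ^+ j <= nc (1 - c * Q ^+ j).
  rewrite lerBlDr -[X in X <= _](Normc.normc1 R) -normcX -Normc.normcM.
  by apply: le_trans (le_normcD _ _); rewrite subrK.
have pos : 0 < 1 - nc c * nc Q ^+ j.
  apply: lt_le_trans c1' _; rewrite lerD2l lerN2.
  by rewrite ler_piMr // normc_ge0.
apply: (@le_trans _ _ (1 - nc c * nc Q ^+ j)^-1).
  by rewrite lef_pV2 ?posrE // (lt_le_trans pos).
rewrite -[X in X <= _]mul1r ler_pdivrMr //.
move: (normc_ge0 c) c1' Qj Qj0; move: (nc c) (nc Q ^+ j) => x t x0 x1 t1 t0.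
have -> : (1 + x / (1 - x) * t) * (1 - x * t)
   = 1 + x * t * (x * (1 - t)) / (1 - x) by field; rewrite gt_eqF.
rewrite lerDl; apply: divr_ge0; last exact: ltW.
by rewrite !mulr_ge0 // subr_ge0.
Qed.

(** Consecutive partial products differ by - c Q^n (c;Q)_n, which is geometrically small. *)
Lemma qpoch_cvg (Q c : C) : nc Q < 1 ->
  (qpoch Q c : nat -> C^o) @ \oo --> (qpoch_inf c Q : C^o).
Proof.
move=> Q1; have [M M0 qM] := qpoch_bounded c Q1.
have [||n|l ql] := @cvgC_geometric_step (qpoch Q c) (M * nc c) (nc Q).
- by rewrite normc_ge0.
- by rewrite mulr_ge0 ?normc_ge0 // ltW.
- rewrite qpochS mulrBr mulr1 addrAC subrr sub0r normcN Normc.normcM.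
  rewrite Normc.normcM normcX -mulrA; apply: ler_pM => //.
  - exact: normc_ge0.
  - by rewrite mulr_ge0 ?exprn_ge0 ?normc_ge0.
apply: cvgP (ql).
Qed.

Lemma subr1_neq0 z : nc z < 1 -> 1 - z != 0.
Proof.
by apply: contraTneq => /subr0_eq <-; rewrite Normc.normc1 ltxx.
Qed.

(** Bounded inverses keep the partial products away from 0. *)
Lemma qpoch_inf_neq0 (Q c : C) : nc Q < 1 -> nc c < 1 -> qpoch_inf c Q != 0.
Proof.
move=> Q1 c1; have [M M0 qM] := qpoch_inv_bounded Q1 c1.
apply/eqP => q0; have /cvgC_normP/cvgrPdist_lt := @qpoch_cvg Q c Q1.
rewrite q0 => /(_ M^-1); rewrite invr_gt0 => /(_ M0)[n _ /(_ n)] /=.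
rewrite leqnn => /(_ isT).
rewrite sub0r normrN subr0 ger0_norm ?normc_ge0 // => lt.
have := qM n; rewrite leNgt => /negP; apply.
have q_gt0 : 0 < nc (qpoch Q c n).
  rewrite lt_def normc_ge0 andbT; apply/eqP => /Normc.eq0_normc/eqP.
  apply/negP/qpoch_neq0 => m; apply: subr1_neq0.
  rewrite Normc.normcM normcX; apply: le_lt_trans c1.
  by rewrite ler_piMr ?normc_ge0 // exprn_ile1 ?normc_ge0 // ltW.
by rewrite -[M]invrK ltf_pV2 ?posrE ?invr_gt0.
Qed.

Lemma cvg_geometric_conv (eps : nat -> R) (rho : R) : 0 <= rho < 1 ->
  (forall n, 0 <= eps n) -> eps @ \oo --> (0 : R) ->
  \sum_(k < n.+1) rho ^+ k * eps (n - k)%N @[n --> \oo] --> (0 : R).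
Proof.
move=> /andP[rho0 rho1] eps0 cvg_eps.
set t := (fun n => _).
have r1 : 0 < 1 - rho by rewrite subr_gt0.
have tS n : t n.+1 = rho * t n + eps n.+1.
  rewrite /t big_ord_recl /= expr0 mul1r subn0 addrC mulr_sumr; congr (_ + _).
  by apply: eq_bigr => k _; rewrite /bump leq0n add1n subSS exprS mulrA.
have t0 n : 0 <= t n.
  by apply: sumr_ge0 => k _; rewrite mulr_ge0 // exprn_ge0.
apply/cvgrPdist_le => e e0.
(* With this bound on [eps], the map t -> rho t + e (1 - rho)/2 has the fixed point e/2, and the
   distance to it contracts by rho. *)
have e1 : 0 < e * (1 - rho) / 2 by rewrite divr_gt0 // mulr_gt0.
move/cvgrPdist_le: cvg_eps => /(_ _ e1)[n0 _ H].
have tb m : t (n0 + m)%N <= rho ^+ m * t n0 + e / 2.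
  elim: m => [|m IH]; first by rewrite addn0 expr0 mul1r lerDl divr_ge0 // ltW.
  rewrite addnS tS exprS.
  have := H (n0 + m).+1; rewrite /= -addnS leq_addr => /(_ isT).
  rewrite sub0r normrN ger0_norm // => H'.
  have := ler_wpM2l rho0 IH; move: H'.
  move: (t (n0 + m)%N) (rho ^+ m) (eps _) (t n0) => A B D F.
  nra.
have : t n0 * rho ^+ m @[m --> \oo] --> (0 : R).
  by apply: (@cvg_geometric R (t n0) rho); rewrite ger0_norm.
have e2 : 0 < e / 2 by rewrite divr_gt0.
move/cvgrPdist_le => /(_ _ e2)[n1 _ H1].
exists (n0 + n1)%N => // n /= n01n.
rewrite sub0r normrN ger0_norm //.
have /subnKC <- : (n0 <= n)%N by rewrite (leq_trans _ n01n) // leq_addr.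
apply: le_trans (tb _) _.
have := H1 (n - n0)%N; rewrite /= leq_subRL; last first.
  by rewrite (leq_trans _ n01n) // leq_addr.
move=> /(_ n01n); rewrite sub0r normrN mulrC => H2.
have := le_trans (ler_norm _) H2; lra.
Qed.

End Limits.

(** * Convergence of the adjoint sequence *)

Section AdjointLimit.
Context {R : realType}.
Local Notation C := R[i].
Local Notation nc := (@Normc.normc R).
Implicit Types (u v : nat -> C) (z l c d Q y : C).

Lemma cvgC_M u v l z : (u : nat -> C^o) @ \oo --> (l : C^o) ->
  (v : nat -> C^o) @ \oo --> (z : C^o) ->
  ((fun n => u n * v n) : nat -> C^o) @ \oo --> (l * z : C^o).
Proof. exact: cvgM. Qed.

Lemma cvgC_V u l : l != 0 -> (u : nat -> C^o) @ \oo --> (l : C^o) ->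
  ((fun n => (u n)^-1) : nat -> C^o) @ \oo --> (l^-1 : C^o).
Proof. exact: cvgV. Qed.

Lemma cvgC_sum (I : eqType) (s : seq I) (F : I -> nat -> C) (L : I -> C) :
  (forall i, i \in s -> (F i : nat -> C^o) @ \oo --> (L i : C^o)) ->
  ((fun n => \sum_(i <- s) F i n) : nat -> C^o) @ \oo
    --> (\sum_(i <- s) L i : C^o).
Proof.
elim: s => [|i s IH] H.
  by rewrite big_nil; under eq_fun do rewrite big_nil; exact: cvg_cst.
rewrite big_cons; under eq_fun do rewrite big_cons.
apply: cvgD; first by apply: H; rewrite mem_head.
by apply: IH => k ks; apply: H; rewrite inE ks orbT.
Qed.

Lemma cvgC_prod (I : eqType) (s : seq I) (F : I -> nat -> C) (L : I -> C) :
  (forall i, i \in s -> (F i : nat -> C^o) @ \oo --> (L i : C^o)) ->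
  ((fun n => \prod_(i <- s) F i n) : nat -> C^o) @ \oo
    --> (\prod_(i <- s) L i : C^o).
Proof.
elim: s => [|i s IH] H.
  by rewrite big_nil; under eq_fun do rewrite big_nil; exact: cvg_cst.
rewrite big_cons; under eq_fun do rewrite big_cons.
apply: cvgC_M; first by apply: H; rewrite mem_head.
by apply: IH => k ks; apply: H; rewrite inE ks orbT.
Qed.

Lemma cvgC_X u l k : (u : nat -> C^o) @ \oo --> (l : C^o) ->
  ((fun n => u n ^+ k) : nat -> C^o) @ \oo --> (l ^+ k : C^o).
Proof.
move=> ul; elim: k => [|k IH]; first exact: cvg_cst.
by rewrite exprS; under eq_fun do rewrite exprS; exact: cvgC_M.
Qed.

Lemma cvgC_cst z : ((fun=> z) : nat -> C^o) @ \oo --> (z : C^o).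
Proof. exact: cvg_cst. Qed.

Lemma cvgC_Zl z u l : (u : nat -> C^o) @ \oo --> (l : C^o) ->
  ((fun n => z * u n) : nat -> C^o) @ \oo --> (z * l : C^o).
Proof. exact: (@cvgC_M (fun=> z) u z l (@cvgC_cst z)). Qed.

Lemma cvgC_Zr z u l : (u : nat -> C^o) @ \oo --> (l : C^o) ->
  ((fun n => u n * z) : nat -> C^o) @ \oo --> (l * z : C^o).
Proof. by move=> ul; exact: (@cvgC_M u (fun=> z) l z ul (@cvgC_cst z)). Qed.

Lemma cvgC_expr Q : nc Q < 1 ->
  ((fun n => Q ^+ n) : nat -> C^o) @ \oo --> (0 : C^o).
Proof.
move=> Q1; apply: (@cvgC_le _ _ _ (geometric 1 (nc Q))).
  by move=> n; rewrite subr0 normcX /geometric /= mul1r.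
by apply: cvg_geometric; rewrite ger0_norm // normc_ge0.
Qed.

(** [bcoef] is polynomial in x and [qcoef] has the factor x, so the limit is the value at x = 0. *)
Lemma cvgC_bcoef d Q ys j u : (u : nat -> C^o) @ \oo --> (0 : C^o) ->
  ((fun n => bcoef d Q ys j (u n)) : nat -> C^o) @ \oo
    --> ((j == 1%N)%:R : C^o).
Proof.
move=> u0; have uN : ((fun n => - u n) : nat -> C^o) @ \oo --> (- 0 : C^o).
  exact: cvgN.
have q0 : qcoef d Q ys j 0 = 0.
  by rewrite /qcoef big1 // => m _; rewrite mulr0 mul0r mulr0.
rewrite (_ : (j == 1%N)%:R = bcoef d Q ys j 0); last first.
  by rewrite /bcoef q0 mul0r addr0.
apply: cvgD; first exact: cvgC_cst.
apply: cvgC_M.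
  apply: cvgC_sum => m _; apply: cvgC_M; first exact: cvgC_cst.
  apply: cvgC_M; first exact: (@cvgC_Zl (esym ys (j + m)) _ _ u0).
  apply: cvgD.
    case: (nat_of_ord m) => [|k]; first exact: cvgC_cst.
    exact: (@cvgC_Zr (gauss Q j k) _ _ (@cvgC_X _ _ k uN)).
  exact: (@cvgC_Zr (gauss Q j m) _ _ (@cvgC_X _ _ m uN)).
apply: cvgC_prod => h _; apply: cvgB; first exact: cvgC_cst.
exact: (@cvgC_Zr (Q ^+ h) _ _ u0).
Qed.

(** The Euler coefficient is y^n Q^(n(n-1)/2)/(Q;Q)_n, and the power of Q has modulus at most 1. *)
Lemma normc_euler_le Q y (M : R) n : nc Q < 1 ->
  (forall n, (nc (qpoch Q Q n))^-1 <= M) -> nc (euler Q y n) <= nc y ^+ n * M.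
Proof.
move=> Q1 HM; apply: le_trans (ler_wpM2l _ (HM n)); last first.
  by rewrite exprn_ge0 // normc_ge0.
elim: n => [|n IH].
  by rewrite euler0 qpoch0 Normc.normc1 expr0 invr1 mulr1.
have Qn : nc (Q ^+ n) <= 1 by rewrite normcX exprn_ile1 ?normc_ge0 // ltW.
rewrite eulerS qpochS -exprS !Normc.normcM Normc.normcV.
rewrite [leRHS](_ : _ = nc y ^+ n / nc (qpoch Q Q n) *
  (nc y / nc (1 - Q ^+ n.+1))); last by rewrite exprSr invfM mulrACA.
apply: ler_pM => //.
- exact: normc_ge0.
- by rewrite !mulr_ge0 ?invr_ge0 ?normc_ge0.
- by rewrite ler_wpM2r ?invr_ge0 ?normc_ge0 // ler_piMr ?normc_ge0.
Qed.

Lemma twist_cvg d Q y (W : nat -> C) l : nc Q < 1 ->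
  nc y < 1 -> nc (d * y) < 1 ->
  ((fun n => qpoch Q Q n * W n) : nat -> C^o) @ \oo --> (l : C^o) ->
  ((fun n => qpoch Q Q n * twist d Q y (addz y W (delay W)) n)
    : nat -> C^o) @ \oo
  --> (qpoch_inf (- y) Q / qpoch_inf (d * y) Q * l : C^o).
Proof.
move=> Q1 y1 dy1 Wl.
have Qn n : 1 - Q ^+ n.+1 != 0.
  apply: subr1_neq0; rewrite normcX.
  by rewrite exprn_ilt1 // normc_ge0.
have QQn n : qpoch Q Q n != 0 by apply: qpoch_neq0 => m; rewrite -exprS.
pose V n := qpoch Q Q n * W n.
pose S n := qpoch Q Q n * convol (euler Q y) W n.
(* By [q_binomial], (-y;Q)_n l is the convolution obtained when V is constantly l, so only the
   errors V - l remain. *)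
have SE n : S n - qpoch Q (- y) n * l = \sum_(k < n.+1)
    qpoch Q Q n * euler Q y k / qpoch Q Q (n - k) * (V (n - k)%N - l).
  rewrite -q_binomial // /S -mulrA -mulrBr /convol mulr_suml -sumrB mulr_sumr.
  by apply: eq_bigr => k _; rewrite /V; field.
have [M1 M10 HM1] := qpoch_bounded Q Q1.
have [M2 M20 HM2] := qpoch_inv_bounded Q1 Q1.
have Sl : ((fun n => S n - qpoch Q (- y) n * l) : nat -> C^o) @ \oo --> (0 : C^o).
  (* [M1] bounds (Q;Q)_n, one [M2] the denominator of the Euler coefficient and the other
     1/(Q;Q)_(n-k). *)
  apply: (@cvgC_le _ _ _ (fun n => M1 * M2 * M2 * \sum_(k < n.+1)
      nc y ^+ k * nc (V (n - k)%N - l))).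
    move=> n; rewrite subr0 SE; apply: (le_trans (normc_sum _)).
    rewrite mulr_sumr. apply: ler_sum => k _.
    rewrite Normc.normcM mulrA; apply: ler_wpM2r; first exact: normc_ge0.
    rewrite !Normc.normcM Normc.normcV.
    apply: (@le_trans _ _ (M1 * (nc y ^+ k * M2) * M2)); last first.
      by rewrite le_eqVlt; apply/orP; left; apply/eqP; ring.
    have yk : 0 <= nc y ^+ k by rewrite exprn_ge0 // normc_ge0.
    apply: ler_pM => //; rewrite ?mulr_ge0 ?invr_ge0 ?normc_ge0 //.
    apply: ler_pM => //; rewrite ?normc_ge0 //.
    exact: normc_euler_le.
  rewrite -[X in _ --> X](mulr0 (M1 * M2 * M2)); apply: cvgM; first exact: cvg_cst.
  apply: (@cvg_geometric_conv _ (fun n => nc (V n - l))).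
  - by rewrite normc_ge0.
  - by move=> n; exact: normc_ge0.
  - exact/cvgC_normP.
have -> : (fun n => qpoch Q Q n * twist d Q y (addz y W (delay W)) n)
   = (fun n => (qpoch Q (d * y) n.+1)^-1 *
       (S n - qpoch Q (- y) n * l + qpoch Q (- y) n * l)).
  by apply/funext => n; rewrite subrK /twist convol_euler // mulrCA.
rewrite [_ / _]mulrC -mulrA; apply: cvgC_M.
  apply: cvgC_V; first exact: qpoch_inf_neq0.
  by rewrite cvg_shiftS; exact: qpoch_cvg.
rewrite -[qpoch_inf (- y) Q * l]add0r.
exact: (cvgD Sl (@cvgC_Zr l _ _ (@qpoch_cvg _ Q (- y) Q1))).
Qed.

Lemma adj_cvg d Q (ys : seq C) : nc Q < 1 ->
  (forall y, y \in ys -> nc y < 1 /\ nc (d * y) < 1) ->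
  (adj d Q ys : nat -> C^o) @ \oo
  --> (\prod_(y <- ys) (qpoch_inf (- y) Q / qpoch_inf (d * y) Q) : C^o).
Proof.
move=> Q1; elim: ys => [|y ys IH] ysP.
  rewrite big_nil (_ : adj d Q [::] = fun=> 1); first exact: cvgC_cst.
  apply/funext => n; rewrite /adj /= divff // qpoch_neq0 // => m.
  apply: subr1_neq0; rewrite -exprS normcX.
  by rewrite exprn_ilt1 // normc_ge0.
rewrite big_cons; have [y1 dy1] := ysP y (mem_head _ _).
apply: twist_cvg => //; apply: IH => z zys.
by apply: ysP; rewrite inE zys orbT.
Qed.

(** The boundary expression of [pairing] equals u_0 for every M; letting M tend to infinity
    evaluates it through the limits of the adjoint sequence and of the coefficients. *)
Lemma q_difference_solution d Q (ys : seq C) (u : nat -> C) : nc Q < 1 ->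
  (forall y, y \in ys -> nc y < 1 /\ nc (d * y) < 1) -> (0 < size ys)%N ->
  (u : nat -> C^o) @ \oo --> (1 : C^o) ->
  (forall n, \prod_(y <- ys) (1 - d * y * Q ^+ n) * u n =
     \sum_(1 <= j < (size ys).+1) bcoef d Q ys j (Q ^+ n) * u (n + j)%N) ->
  u 0%N = \prod_(y <- ys) (qpoch_inf (- y) Q / qpoch_inf (d * y) Q).
Proof.
move=> Q1 ysP ys0 u1 u_eq; set L := RHS; set r := size ys in ys0 u_eq.
have Qn n : 1 - Q ^+ n.+1 != 0.
  by apply: subr1_neq0; rewrite normcX exprn_ilt1 // normc_ge0.
have yQ y : y \in ys -> forall n, 1 - d * y * Q ^+ n != 0.
  move=> /ysP[_ dy1] n; apply: subr1_neq0; rewrite Normc.normcM normcX.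
  apply: le_lt_trans dy1; rewrite ler_piMr ?normc_ge0 //.
  by rewrite exprn_ile1 ?normc_ge0 // ltW.
pose G j n := bcoef d Q ys j (Q ^+ n) * adj d Q ys n * u (n + j)%N.
have G_cvg j : (G j : nat -> C^o) @ \oo --> ((j == 1%N)%:R * L * 1 : C^o).
  apply: cvgC_M; last by rewrite (cvg_shiftn j).
  by apply: cvgC_M; [exact/cvgC_bcoef/cvgC_expr | exact: adj_cvg].
have uE M : u 0%N = \sum_(1 <= j < r.+1) \sum_(0 <= i < j) G j (r + M + i - j)%N.
  exact: (@pairing _ r _ _ _ (fun j n => bcoef d Q ys j (Q ^+ n))) ys0 u_eq
    (fun n => adj_rec n Qn yQ ys0).
have : ((fun M => \sum_(1 <= j < r.+1) \sum_(0 <= i < j) G j (r + M + i - j)%N)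
    : nat -> C^o) @ \oo -->
    (\sum_(1 <= j < r.+1) \sum_(0 <= i < j) (j == 1%N)%:R * L * 1 : C^o).
  apply: cvgC_sum => j; rewrite mem_index_iota => /andP[_ jr].
  apply: cvgC_sum => i _.
  have -> : (fun M => G j (r + M + i - j)%N) = (fun M => G j (M + (r + i - j))%N).
    apply/funext => M; congr G.
    by rewrite addnBA 1?(leq_trans _ (leq_addr _ _)) // addnA [(M + r)%N]addnC.
  by rewrite (cvg_shiftn (r + i - j) (G j : nat -> C^o)); exact: G_cvg.
under eq_fun do rewrite -uE.
move=> /(cvg_lim (@norm_hausdorff _ C^o)).
rewrite (cvg_lim (@norm_hausdorff _ C^o) (@cvgC_cst (u 0%N))) => ->.
(* Only j = 1 survives, with the single index i = 0. *)
rewrite big_ltn // big_nat1 eqxx mul1r mulr1 big_nat big1 ?addr0 //.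
move=> j /andP[j1 _]; rewrite big1 // => i _.
by rewrite gtn_eqF // !mul0r.
Qed.

End AdjointLimit.

(** * Specialization to y_k = q^a(k) and u_n = f(Q^n) *)

Theorem theorem7 (R : realType) (r : nat) (a : nat -> int) (N : int)
    (d q : R[i]) (f : R[i] -> R[i])
    (hr : (1 <= r)%N)
    (ha_inj : forall k l : nat, (1 <= k <= r)%N -> (1 <= l <= r)%N ->
       a k = a l -> k = l)
    (ha_grow : forall k : nat, (1 <= k <= r)%N ->
       \sum_(1 <= i < k) a i < a k)
    (ha_sums : nonempty_sums_distinct a r)
    (hN : alpha a r (2 ^ r - 1)%N <= N)
    (ha_next : a r.+1 = N + a 1%N)
    (hd : `|d| < 1) (hq : `|q| < 1)
    (f_cont : {for 0, continuous (f : R[i]^o -> R[i]^o)})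
    (f0 : f 0 = 1)
    (f_eq : forall x : R[i], `|x| <= 1 ->
       \prod_(1 <= j < r.+1) (1 - d * x * q ^ a j) * f x =
       f (x * q ^ N) +
       \sum_(1 <= j < r.+1)
         qdiff_coef a r N d q j x *
         \prod_(1 <= h < j) (1 - x * q ^ (h%:Z * N)) *
         f (x * q ^ (j%:Z * N))) :
  f 1 = \prod_(1 <= k < r.+1)
          (qpoch_inf (- q ^ a k) (q ^ N) / qpoch_inf (d * q ^ a k) (q ^ N)).

Proof.
have a0 : forall k, (1 <= k <= r)%N -> 0 < a k by exact: superincreasing_gt0.
have a1 : 0 < a 1%N by rewrite a0.
(* The singleton of the first index puts a(1) in A', whence 0 < a(1) <= N. *)
have a1A : a 1%N \in sums a r.
  rewrite (perm_mem (perm_sums ha_sums)); apply/fintype.imageP.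
  exists (finset.set1 (Ordinal hr)); last by rewrite /subset_sum big_set1.
  by rewrite inE; apply/finset.set0Pn; exists (Ordinal hr); rewrite finset.set11.
have aN s : s \in sums a r -> s <= N.
  by move=> /(sums_le_alpha ha_sums) /le_trans; apply.
have N0 : 0 < N by exact: lt_le_trans a1 (aN _ a1A).
(* alpha <= N < N + a(1) = a(r+1). *)
have aS s : s \in sums a r -> s < a r.+1.
  by move=> /aN sN; rewrite ha_next (le_lt_trans sN) // ltrDl.
(* As N > 0, it is a natural number [M]. *)
case: N N0 {hN ha_next aN} f_eq => // M M0 f_eq.
have q1 : Normc.normc q < 1 by rewrite -ltcR.
have d1 : Normc.normc d < 1 by rewrite -ltcR.
have Q1 : Normc.normc (q ^+ M) < 1.
  by rewrite normcX exprn_ilt1 ?normc_ge0 // -lt0n.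
have Qn n : 1 - (q ^+ M) ^+ n.+1 != 0.
  by apply: subr1_neq0; rewrite normcX exprn_ilt1 // normc_ge0.
pose ys := [seq q ^ a i.+1 | i : 'I_r].
have rE : size ys = r by rewrite size_map size_enum_ord.
have prodE (F : R[i] -> R[i]) :
    \prod_(y <- ys) F y = \prod_(1 <= k < r.+1) F (q ^ a k).
  by rewrite big_map big_enum big_add1 big_mkord.
rewrite -(prodE (fun y => qpoch_inf (- y) _ / qpoch_inf (d * y) _)).
(* Writing 1 = Q^0 makes f(1) the term u_0. *)
rewrite -[1 in LHS](expr0 (q ^+ M)).
apply: (@q_difference_solution _ d (q ^+ M) ys (fun n => f ((q ^+ M) ^+ n))) => //.
- move=> y /fintype.imageP[i _ ->]; have := a0 i.+1 (ltn_ord i).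
  case: (a i.+1) => // k k0.
  have yk : Normc.normc (q ^ k) < 1.
    by rewrite -exprnP normcX exprn_ilt1 ?normc_ge0 // -lt0n.
  split=> //; rewrite Normc.normcM; apply: le_lt_trans yk.
  by rewrite ler_piMl ?normc_ge0 // ltW.
- by rewrite rE.
(* Since Q^n -> 0, continuity of f at 0 gives u_n -> f(0) = 1. *)
- rewrite -f0; apply: (continuous_cvg _ f_cont); exact: cvgC_expr.
(* The points Q^n lie in the closed unit disc, where the equation is assumed. *)
move=> n; have Qn1 : `|(q ^+ M) ^+ n| <= 1.
  rewrite -[_ <= _]/((Normc.normc _)%:C <= 1%:C) lecR normcX.
  by rewrite exprn_ile1 ?normc_ge0 // ltW.
rewrite rE (prodE (fun y => 1 - d * y * (q ^+ M) ^+ n)).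
have := f_eq _ Qn1.
under eq_bigr do rewrite mulrAC.
move=> ->.
have QE (h : nat) : q ^ (h%:Z * M%:Z) = (q ^+ M) ^+ h.
  by rewrite -PoszM -exprnP mulnC exprM.
(* The term f(xQ) is the contribution of the Kronecker symbol at j = 1. *)
under [in RHS]eq_bigr do rewrite /bcoef mulrDl.
rewrite big_split /=; congr (_ + _).
  rewrite big_ltn // eqxx mul1r big_nat big1 ?addr0 => [|j /andP[j1 _]].
    by rewrite addn1 exprSr.
  by rewrite gtn_eqF // mul0r.
apply: eq_big_nat => j /andP[j1 _]; rewrite qdiff_coefE // QE -exprD.
by congr (_ * _ * _); apply: eq_bigr => h _; rewrite QE.
Qed.
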